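(* Let $(\alpha^{(m)})_{m\ge 0}$ and $(\beta^{(m)})_{m\ge 0}$ be sequences of positive real numbers, and let $(K^{(m)})_{m\ge 0}$ be a time-inhomogeneous Markov chain with state space $\mathbb{N}=\{0,1,2,\dots\}$, with finite initial state $K^{(0)}\in\mathbb{N}$, whose transition probabilities at time $m$ are, for all $k\in\mathbb{N}$, $$p\big(K^{(m+1)}=k\mid K^{(m)},\alpha^{(m)},\beta^{(m)}\big)=\frac{1}{k!}\exp\left\{-\alpha^{(m)}\sum_{k'=1}^{K^{(m)}}\frac{\beta^{(m)}}{k'+\beta^{(m)}-1}\right\}\left(\alpha^{(m)}\sum_{k'=1}^{K^{(m)}}\frac{\beta^{(m)}}{k'+\beta^{(m)}-1}\right)^{k}.$$ If there exist $\bar\alpha<\infty$ and $\bar\beta<\infty$ such that $\alpha^{(m)}<\bar\alpha$ and $\beta^{(m)}<\bar\beta$ for all $m$, then $$\lim_{m\to\infty}p\big(K^{(m)}=0\big)=1.$$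
   Context: Conventions: an empty sum equals $0$ and $0^0=1$. Thus, given $K^{(m)}$, the variable $K^{(m+1)}$ is Poisson distributed with mean $\alpha^{(m)}\sum_{k'=1}^{K^{(m)}}\frac{\beta^{(m)}}{k'+\beta^{(m)}-1}$, and the state $0$ is absorbing. The chain describes the layer widths (numbers of nonzero columns of successive binary matrices) in the cascading Indian buffet process with depth-dependent parameters $\alpha^{(m)},\beta^{(m)}$; the claim relies only on the Markov chain defined in it. *)

(* Defs.v *)
From HB Require Import structures.
From mathcomp Require Import all_boot all_order all_algebra.
From mathcomp Require Import all_classical all_reals all_analysis.
Set Implicit Arguments.
Unset Strict Implicit.
Unset Printing Implicit Defensive.
Import Order.TTheory GRing.Theory Num.Theory numFieldNormedType.Exports.
Local Open Scope classical_set_scope.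
Local Open Scope ring_scope.

(* P(A | B); only meaningful when 0 < P B. *)
Definition cond_prob d (Omega : measurableType d) (R : realType)
    (P : probability Omega R) (A B : set Omega) : R :=
  fine (P (A `&` B)) / fine (P B).

Section markov_chain.
Context d (Omega : measurableType d) (R : realType) (P : probability Omega R).
Variable K : nat -> {RV P >-> nat}.

Definition state_event (m k : nat) : set Omega := [set w | K m w = k].

(* The path x is an infinite sequence of which only x 0, ..., x m are used. *)
Definition history_event (m : nat) (x : nat -> nat) : set Omega :=
  [set w | forall i, (i <= m)%N -> K i w = x i].

Definition markov_property : Prop :=
  forall (m k : nat) (x : nat -> nat), (0 < P (history_event m x))%E ->
    cond_prob P (state_event m.+1 k) (history_event m x) =
    cond_prob P (state_event m.+1 k) (state_event m (x m)).

Definition has_transitions (p : nat -> nat -> nat -> R) : Prop :=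
  forall m j k : nat, (0 < P (state_event m j))%E ->
    cond_prob P (state_event m.+1 k) (state_event m j) = p m j k.

(* The law of K 0 is an arbitrary distribution on nat; a deterministic initial
   state is the case of a Dirac mass. *)
Definition markov_chain (p : nat -> nat -> nat -> R) : Prop :=
  markov_property /\ has_transitions p.

End markov_chain.

Section transitions.
Variable R : realType.

Definition ibp_mean (alpha beta : R) (j : nat) : R :=
  alpha * \sum_(1 <= k' < j.+1) beta / (k'%:R + beta - 1).

(* The library's poisson_pmf is not used: it is constantly 1 when the rate is
   0, whereas here, with 0 ^+ 0 = 1, state 0 is absorbing. *)
Definition ibp_transition (alpha beta : R) (j k : nat) : R :=
  (k`!%:R)^-1 * expR (- ibp_mean alpha beta j) * ibp_mean alpha beta j ^+ k.

End transitions.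

(* Main.v *)
Require Import Defs.
From HB Require Import structures.
From mathcomp Require Import all_boot all_order all_algebra.
From mathcomp Require Import all_classical all_reals all_analysis.
From mathcomp Require Import ring lra.
Set Implicit Arguments.
Unset Strict Implicit.
Unset Printing Implicit Defensive.
Import Order.TTheory GRing.Theory Num.Theory numFieldNormedType.Exports.
Local Open Scope classical_set_scope.
Local Open Scope ring_scope.

(** Only finite sums of one-step transition probabilities are used.  The Poisson
    mean in state [j] grows logarithmically in [j], so Markov's inequality at the
    scales [4 ^ n] gives
      P(K_(m+1) < 4^n) >= P(K_m < 4^(n+1)) - C / 2^n.
    The errors are summable along n, n+1, n+2, ..., hence
      P(K_m < 4^n) >= P(K_0 < 4^n) - 2C / 2^n   for all m:
    the laws of the K_m are tight, without any moment assumption on K_0.  From a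
    state below [4 ^ n] the chain jumps to the absorbing state 0 with probability
    at least e_n > 0, so the nondecreasing sequence q_m = P(K_m = 0) satisfies
      q_(m+1) >= q_m + e_n (P(K_m < 4^n) - q_m),
    and its limit is at least P(K_0 < 4^n) - 2C / 2^n for every n. *)

(** * Events of a natural-valued random variable *)

Lemma measurable_preimage_nat d (Omega : measurableType d) (R : realType)
    (P : probability Omega R) (X : {RV P >-> nat}) (S : set nat) :
  measurable (X @^-1` S).
Proof. exact: measurable_funPTI. Qed.

Lemma fine_probability_ge0 d (Omega : measurableType d) (R : realType)
    (P : probability Omega R) (A : set Omega) : 0 <= fine (P A).
Proof. exact/fine_ge0/measure_ge0. Qed.

Lemma EFin_fine_probability d (Omega : measurableType d) (R : realType)
    (P : probability Omega R) (A : set Omega) :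
  measurable A -> (fine (P A))%:E = P A.
Proof. by move=> mA; rewrite fineK// fin_num_measure. Qed.

Lemma le_fine_probability d (Omega : measurableType d) (R : realType)
    (P : probability Omega R) (A B : set Omega) :
  measurable A -> measurable B -> A `<=` B -> fine (P A) <= fine (P B).
Proof.
move=> mA mB AB; rewrite -lee_fin !EFin_fine_probability//.
by apply: le_measure; rewrite ?inE.
Qed.

(** The extra event [B] lets one decomposition serve for the current state, for the next state, and,
    with [B] the whole space, for a single law. *)
Lemma fine_probability_lt_sum d (Omega : measurableType d) (R : realType)
    (P : probability Omega R) (X : {RV P >-> nat}) (B : set Omega) (N : nat) :
  measurable B ->
  fine (P (B `&` [set w | (X w < N)%N])) =
  \sum_(0 <= j < N) fine (P (B `&` [set w | X w = j])).
Proof.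
move=> mB; elim: N => [|N IHN].
  by rewrite big_geq// (_ : _ `&` _ = set0) ?measure0// -subset0 => w [].
have mX (S : set nat) : measurable (B `&` X @^-1` S).
  exact/measurableI/measurable_preimage_nat.
rewrite big_nat_recr//= -IHN.
have mlt := mX [set j | (j < N)%N]; have meq := mX [set N].
rewrite -fineD ?fin_num_measure// -measureU//; last first.
  by rewrite -subset0 => w [[_ /= h] [_ /= e]]; move: h; rewrite e ltnn.
congr (fine (P _)); apply/seteqP; split => w /=.
  by move=> [Bw]; rewrite ltnS leq_eqVlt => /orP[/eqP|]; [right|left].
by move=> [] [Bw h]; split=> //; [exact: ltnW|rewrite h].
Qed.

(** Continuity from below: [X] takes finite values, so these events increase to the whole space. *)
Lemma cvg_fine_probability_lt d (Omega : measurableType d) (R : realType)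
    (P : probability Omega R) (X : {RV P >-> nat}) :
  fine (P [set w | (X w < N)%N]) @[N --> \oo] --> (1 : R).
Proof.
have mX N : measurable [set w | (X w < N)%N].
  exact: (measurable_preimage_nat X [set j | (j < N)%N]).
have XT : \bigcup_N [set w | (X w < N)%N] = setT.
  by rewrite -subTset => w _; exists (X w).+1 => /=.
apply: fine_cvg; rewrite -(probability_setT P) -XT.
apply: nondecreasing_cvg_mu => //; first by rewrite XT.
by move=> m n mn; apply/subsetPset => w /= h; exact: leq_trans mn.
Qed.

(** * Bounds on the mean and on the Poisson tail *)

Lemma ibp_mean_ge0 (R : realType) (a b : R) (j : nat) :
  0 < a -> 0 < b -> 0 <= ibp_mean a b j.
Proof.
move=> a0 b0; apply: mulr_ge0; first exact: ltW.
rewrite big_nat; apply: sumr_ge0 => k /andP[k1 _].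
have : 1 <= k%:R :> R by rewrite ler1n.
by move=> ?; apply: divr_ge0; lra.
Qed.

Lemma ibp_mean0 (R : realType) (a b : R) : ibp_mean a b 0 = 0.
Proof. by rewrite /ibp_mean big_geq// mulr0. Qed.

Lemma ler_ibp_mean_harmonic (R : realType) (a b A B : R) (j : nat) :
  0 < a -> a <= A -> 0 < b -> b <= B -> 1 <= B ->
  ibp_mean a b j <= A * B * \sum_(1 <= k < j.+1) (k%:R)^-1.
Proof.
move=> a0 aA b0 bB B1; rewrite -mulrA; apply: ler_pM; first exact: ltW.
- rewrite big_nat; apply: sumr_ge0 => k /andP[k1 _].
  have : 1 <= k%:R :> R by rewrite ler1n.
  by move=> ?; apply: divr_ge0; lra.
- exact: aA.
- rewrite mulr_sumr; apply: ler_sum_nat => k /andP[k1 _].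
  have k1' : 1 <= k%:R :> R by rewrite ler1n.
  rewrite ler_pdivrMr; last lra.
  rewrite mulrAC ler_pdivlMr; last lra.
  (* [B (k + b - 1) - b k = (B - b) (k - 1) + b (B - 1)], where all factors are nonnegative. *)
  by nra.
Qed.

(* The harmonic sum grows by at most 3 when its range is multiplied by 4. *)
Lemma harmonic_expn4_le (R : realType) (n : nat) :
  \sum_(1 <= k < (4 ^ n).+1) (k%:R)^-1 <= 3 * 2 ^+ n :> R.
Proof.
elim: n => [|n IHn].
  by rewrite expn0 expr0 big_nat1 invr1; lra.
have n4 : (0 < 4 ^ n)%N by rewrite expn_gt0.
rewrite (@big_cat_nat _ _ _ (4 ^ n).+1) //=; last first.
  by rewrite ltnS leq_exp2l.
have p1 : 1 <= 2 ^+ n :> R by apply: exprn_ege1; lra.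
have : \sum_((4 ^ n).+1 <= k < (4 ^ n.+1).+1) (k%:R)^-1 <= 3 :> R.
  apply: (@le_trans _ _
    (\sum_((4 ^ n).+1 <= k < (4 ^ n.+1).+1) (4 ^ n)%:R^-1)).
    apply: ler_sum_nat => k /andP[k1 _].
    by rewrite lef_pV2 ?posrE ?ltr0n ?ler_nat ?(ltnW k1)//; exact: leq_trans k1.
  rewrite sumr_const_nat subSS expnS -[X in (_ - X)%N]mul1n -mulnBl.
  rewrite -[X in X <= _]mulr_natr natrM mulrCA mulVf ?mulr1//.
(* The growth is only linear in [n], but doubling is enough: divided by the scale [4 ^ n], it leaves
   a summable error of order [1 / 2 ^ n]. *)
by rewrite exprS; move: IHn; lra.
Qed.

Lemma poisson_lt_ge (R : realType) (x : R) (N : nat) :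
  0 <= x -> (0 < N)%N ->
  1 - x / N%:R <= \sum_(0 <= k < N) (k`!%:R)^-1 * expR (- x) * x ^+ k.
Proof.
move=> x0 N0.
have S_le n : series (exp_coeff x) n <= expR x.
  apply: (@nondecreasing_cvgn_le _ (series (exp_coeff x))); last first.
    exact: is_cvg_series_exp_coeff.
  apply/nondecreasing_seqP => m.
  by rewrite !seriesEnat/= big_nat_recr//= lerDl exp_coeff_ge0.
have N0' : 0 < N%:R :> R by rewrite ltr0n.
(* x^k / k! <= (x / N) (x^(k-1) / (k-1)!) for k >= N: Markov's inequality. *)
have tail M : series (exp_coeff x) (N + M) <=
    series (exp_coeff x) N + x / N%:R * expR x.
  apply: (@le_trans _ _ (series (exp_coeff x) N
      + x / N%:R * \sum_(N <= k < N + M) exp_coeff x k.-1)).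
    rewrite seriesEnat /= (@big_cat_nat _ _ _ N) ?leq_addr//= lerD2l mulr_sumr.
    apply: ler_sum_nat => k /andP[Nk _].
    have k0 : (0 < k)%N by exact: leq_trans Nk.
    rewrite /exp_coeff /=; case: k k0 Nk => // k _ Nk /=.
    rewrite exprS factS natrM invfM mulrACA.
    apply: ler_wpM2r; first by rewrite divr_ge0// exprn_ge0.
    apply: ler_wpM2l => //.
    by rewrite lef_pV2 ?posrE ?ltr0n// ler_nat.
  rewrite lerD2l; apply: ler_wpM2l; first by rewrite divr_ge0.
  apply: le_trans (S_le (N + M).-1).
  (* Shifting the index by one gives the terms from [N.-1] to [(N + M).-2], a final segment of the
     partial sum on the right. *)
  rewrite seriesEnat/= -{1}(prednK N0) -(@prednK (N + M)) ?addn_gt0 ?N0//=.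
  rewrite big_add1 /= [leRHS](@big_cat_nat _ _ _ N.-1)//=; last first.
    by rewrite -!subn1 leq_sub2r// leq_addr.
  by rewrite lerDr sumr_ge0// => k _; rewrite exp_coeff_ge0.
(* Let [M] tend to infinity in [tail]. *)
have le_exp : expR x <= series (exp_coeff x) N + x / N%:R * expR x.
  apply: limr_le; first exact: is_cvg_series_exp_coeff.
  near=> n; have Nn : (N <= n)%N by near: n; exact: nbhs_infty_ge.
  by rewrite -(subnKC Nn).
rewrite (eq_bigr (fun k => expR (- x) * exp_coeff x k)); last first.
  by move=> k _; rewrite /exp_coeff /= mulrAC mulrC [X in _ * X]mulrC.
rewrite -mulr_sumr expRN [leRHS]mulrC ler_pdivlMr ?expR_gt0//.
by rewrite mulrBl mul1r lerBlDr; move: le_exp; rewrite seriesEnat.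
Unshelve. all: by end_near. Qed.

(** * One-step bounds from the transition probabilities *)

Section transition_bounds.
Context d (Omega : measurableType d) (R : realType) (P : probability Omega R).
Variables (K : nat -> {RV P >-> nat}) (p : nat -> nat -> nat -> R).
Hypothesis Kp : has_transitions K p.

Lemma measurable_state_event m k : measurable (state_event K m k).
Proof. exact: (measurable_preimage_nat (K m) [set k]). Qed.

(** The product form also covers a null conditioning event, where both sides vanish, so states can
    be summed over without case distinction. *)
Lemma fine_probability_step m j k :
  fine (P (state_event K m j `&` state_event K m.+1 k)) =
  fine (P (state_event K m j)) * p m j k.
Proof.
have mS := measurable_state_event.
have [P0|] := eqVneq (P (state_event K m j)) 0%E.
  rewrite P0 mul0r; apply/eqP; rewrite eq_le fine_probability_ge0 andbT.
  have <- : fine (P (state_event K m j)) = 0 by rewrite P0.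
  by apply: le_fine_probability => //; exact: measurableI.
rewrite -measure_gt0 => P0; have := Kp k P0.
rewrite setIC => <-; rewrite /cond_prob mulrC divfK// gt_eqF//.
by rewrite -lte_fin EFin_fine_probability.
Qed.

(** Condition on the state at time [m] and discard the states from [N'] on. A constant [c] gives
    tightness; [N = 1] gives absorption. *)
Lemma probability_lt_next_ge m N N' (c : nat -> R) :
  (forall j, (j < N')%N -> c j <= \sum_(0 <= k < N) p m j k) ->
  \sum_(0 <= j < N') c j * fine (P (state_event K m j)) <=
  fine (P [set w | (K m.+1 w < N)%N]).
Proof.
move=> cp; have mS := measurable_state_event.
have mlt i n : measurable [set w | (K i w < n)%N].
  exact: (measurable_preimage_nat (K i) [set j | (j < n)%N]).
apply: (@le_trans _ _ (fine (P ([set w | (K m.+1 w < N)%N] `&`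
                                [set w | (K m w < N')%N])))); last first.
  by apply: le_fine_probability => //; exact: measurableI.
rewrite fine_probability_lt_sum// big_nat [leRHS]big_nat.
apply: ler_sum => j /andP[_ jN'].
rewrite setIC fine_probability_lt_sum; last exact: mS.
rewrite (eq_bigr (fun k => fine (P (state_event K m j)) * p m j k)); last first.
  by move=> k _; rewrite -fine_probability_step.
rewrite -mulr_sumr mulrC; apply: ler_wpM2l; last exact: cp.
exact: fine_probability_ge0.
Qed.

End transition_bounds.

Lemma fine_probability_lt_sum_state d (Omega : measurableType d)
    (R : realType) (P : probability Omega R) (K : nat -> {RV P >-> nat})
    (m N : nat) :
  fine (P [set w | (K m w < N)%N]) =
  \sum_(0 <= j < N) fine (P (state_event K m j)).
Proof.
rewrite -[X in P X]setTI fine_probability_lt_sum//.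
by apply: eq_bigr => j _; rewrite setTI.
Qed.

(** * Tightness and absorption of the chain *)

Section ibp_chain.
Context d (Omega : measurableType d) (R : realType) (P : probability Omega R).
Variables (alpha beta : nat -> R) (K : nat -> {RV P >-> nat}) (A B : R).
Hypothesis alpha_bound : forall m, 0 < alpha m <= A.
Hypothesis beta_bound : forall m, 0 < beta m <= B.
Hypothesis B_ge1 : 1 <= B.
Hypothesis Kp : has_transitions K
  (fun m j k => ibp_transition (alpha m) (beta m) j k).

Lemma ibp_mean_expn4_le m j n : (j <= 4 ^ n)%N ->
  ibp_mean (alpha m) (beta m) j <= 3 * A * B * 2 ^+ n.
Proof.
move=> jn; have /andP[a0 aA] := alpha_bound m.
have /andP[b0 bB] := beta_bound m.
apply: le_trans (ler_ibp_mean_harmonic _ a0 aA b0 bB B_ge1) _.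
rewrite (_ : 3 * A * B * _ = A * B * (3 * 2 ^+ n)); last by ring.
apply: ler_wpM2l; first by apply: mulr_ge0; lra.
apply: le_trans (harmonic_expn4_le R n).
rewrite [leRHS](@big_cat_nat _ _ _ j.+1)//=.
by rewrite lerDl sumr_ge0// => k _; rewrite invr_ge0.
Qed.

(** Below [4 ^ n.+1] the mean is at most [3 * A * B * 2 ^+ n.+1 = C * 2 ^+ n]; Markov's inequality
    divides this by [4 ^ n]. *)
Let C := 6 * A * B.

Lemma probability_lt_expn4_step m n :
  fine (P [set w | (K m w < 4 ^ n.+1)%N]) - C / 2 ^+ n <=
  fine (P [set w | (K m.+1 w < 4 ^ n)%N]).
Proof.
have /andP[a0 aA] := alpha_bound m; have /andP[b0 bB] := beta_bound m.
have C0 : 0 <= C by rewrite /C; do 2 (apply: mulr_ge0; last lra); lra.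
have p2 : 0 < 2 ^+ n :> R by rewrite exprn_gt0.
have Cn : 0 <= C / 2 ^+ n by rewrite divr_ge0// ltW.
apply: le_trans (probability_lt_next_ge Kp (N := 4 ^ n) (N' := 4 ^ n.+1)
    (c := fun=> 1 - C / 2 ^+ n) _); last first.
  move=> j jn.
  apply: le_trans (poisson_lt_ge (ibp_mean_ge0 j a0 b0) _); last first.
    by rewrite expn_gt0.
  rewrite lerD2l lerN2 ler_pdivrMr ?ltr0n ?expn_gt0//.
  apply: le_trans (ibp_mean_expn4_le m (ltnW jn)) _.
  rewrite natrX (_ : 4%:R = 2 * 2 :> R); last by rewrite -natrM.
  rewrite exprMn mulrA divfK ?gt_eqF//.
  by rewrite exprS /C le_eqVlt; apply/orP; left; apply/eqP; ring.
(* The error carries the weight [P(K_m < 4 ^ n.+1)], which is at most 1. *)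
rewrite -mulr_sumr -fine_probability_lt_sum_state mulrBl mul1r lerD2l lerN2.
rewrite ler_piMr// -lee_fin EFin_fine_probability; last first.
  exact: (measurable_preimage_nat (K m) [set j | (j < 4 ^ n.+1)%N]).
apply: probability_le1.
exact: (measurable_preimage_nat (K m) [set j | (j < 4 ^ n.+1)%N]).
Qed.

(** Induction on [m] for all [n] at once: the hypothesis at [n.+1] loses
    [2C / 2 ^ n.+1 = C / 2 ^ n], and the last step loses as much again. *)
Lemma probability_lt_expn4_ge m n :
  fine (P [set w | (K 0 w < 4 ^ n)%N]) - 2 * C / 2 ^+ n <=
  fine (P [set w | (K m w < 4 ^ n)%N]).
Proof.
have /andP[a0 aA] := alpha_bound 0; have /andP[b0 bB] := beta_bound 0.
have C0 : 0 <= C by rewrite /C; do 2 (apply: mulr_ge0; last lra); lra.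
have mlt i N : measurable [set w | (K i w < N)%N].
  exact: (measurable_preimage_nat (K i) [set j | (j < N)%N]).
elim: m n => [|m IHm] n.
  by rewrite gerBl divr_ge0 ?exprn_ge0// mulr_ge0.
apply: le_trans (probability_lt_expn4_step m n).
have := IHm n.+1.
have -> : 2 * C / 2 ^+ n.+1 = C / 2 ^+ n.
  by rewrite exprS invfM mulrACA mulfV// mul1r.
rewrite -mulrA (_ : 2 * (C / 2 ^+ n) = C / 2 ^+ n + C / 2 ^+ n); last by ring.
have : fine (P [set w | (K 0 w < 4 ^ n)%N]) <=
    fine (P [set w | (K 0 w < 4 ^ n.+1)%N]).
  apply: le_fine_probability => // w /= h.
  by apply: leq_trans h _; rewrite leq_exp2l.
by lra.
Qed.

Let q m := fine (P (state_event K m 0)).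

(** State 0 keeps its mass, its mean being an empty sum; any other state [j] below [4 ^ n] jumps to
    0 with probability [exp (- mean)], bounded below through the mean bound at scale [n]. *)
Lemma probability_eq0_step m n :
  q m + expR (- (3 * A * B * 2 ^+ n)) *
    (fine (P [set w | (K m w < 4 ^ n)%N]) - q m) <= q m.+1.
Proof.
set e := expR _.
have -> : q m.+1 = fine (P [set w | (K m.+1 w < 1)%N]).
  by rewrite fine_probability_lt_sum_state big_nat1.
apply: le_trans (probability_lt_next_ge Kp (N := 1) (N' := 4 ^ n)
    (c := fun j => if j is 0 then 1 else e) _); last first.
  move=> j jn; rewrite big_nat1 /ibp_transition fact0 invr1 mul1r expr0 mulr1.
  case: j jn => [_|j jn]; first by rewrite ibp_mean0 oppr0 expR0.
  by rewrite ler_expR lerN2; exact/ibp_mean_expn4_le/ltnW.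
have n4 : (0 < 4 ^ n)%N by rewrite expn_gt0.
rewrite fine_probability_lt_sum_state big_ltn// [leRHS]big_ltn// mul1r lerD2l.
rewrite addrAC subrr add0r mulr_sumr.
by apply: ler_sum_nat => -[|j].
Qed.

Lemma probability_eq0_cvg : q m @[m --> \oo] --> (1 : R).
Proof.
have mlt i N : measurable [set w | (K i w < N)%N].
  exact: (measurable_preimage_nat (K i) [set j | (j < N)%N]).
have q_le m N : (0 < N)%N -> q m <= fine (P [set w | (K m w < N)%N]).
  move=> N0; rewrite /q fine_probability_lt_sum_state big_ltn// lerDl sumr_ge0//.
  by move=> j _; exact: fine_probability_ge0.
have q1 m : q m <= 1.
  rewrite -lee_fin EFin_fine_probability; last exact: measurable_state_event.
  exact/probability_le1/measurable_state_event.
have q_nd : nondecreasing_seq q.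
  apply/nondecreasing_seqP => m; apply: le_trans (probability_eq0_step m 0).
  by rewrite lerDl mulr_ge0 ?expR_ge0// subr_ge0 q_le.
have q_cvg : cvgn q by apply: nondecreasing_is_cvgn => //; exists 1 => _ [m _ <-].
suff <- : limn q = 1 by exact: q_cvg.
have lim_le1 : limn q <= 1 by apply: limr_le => //; exact: nearW.
apply/eqP; rewrite eq_le lim_le1 /=.
have lim_ge n : fine (P [set w | (K 0 w < 4 ^ n)%N]) - 2 * C / 2 ^+ n <= limn q.
  set b := (X in X <= _); set e := expR (- (3 * A * B * 2 ^+ n)).
  have e0 : 0 < e by exact: expR_gt0.
  (* [b] bounds [P(K_m < 4 ^ n)] from below uniformly in [m], so the one-step inequality passes to
     the limit; as [e > 0], it forces [b <= limn q]. *)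
  have : limn q + e * (b - limn q) <= limn q.
    have cvgL : q m + e * (b - q m) @[m --> \oo] --> limn q + e * (b - limn q).
      by apply: cvgD => //; apply: cvgMr; apply: cvgB => //; exact: cvg_cst.
    rewrite -{1}(cvg_lim _ cvgL)//.
    apply: limr_le; first by apply/cvg_ex; eexists; exact: cvgL.
    apply: nearW => m; apply: le_trans (nondecreasing_cvgn_le q_nd q_cvg m.+1).
    apply: le_trans (probability_eq0_step m n).
    by rewrite lerD2l ler_pM2l// lerD2r probability_lt_expn4_ge.
  by rewrite gerDl pmulr_rle0// subr_le0.
have cvgR : fine (P [set w | (K 0 w < 4 ^ n)%N]) - 2 * C / 2 ^+ n
    @[n --> \oo] --> (1 : R).
  rewrite -[X in _ --> X]subr0; apply: cvgB.
    apply: (cvg_comp _ _ _ (cvg_fine_probability_lt (K 0))).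
    apply/cvgnyPge => N; near=> n; apply: leq_trans (ltnW (ltn_expl n _)) => //.
    near: n; exact: nbhs_infty_ge.
  under eq_fun do rewrite -exprVn.
  by apply: cvg_geometric; rewrite ger0_norm; lra.
rewrite -(cvg_lim _ cvgR)//.
by apply: limr_le; [apply/cvg_ex; eexists; exact: cvgR|exact: nearW].
Unshelve. all: by end_near. Qed.

End ibp_chain.

Theorem theoremA1 (R : realType) (d : measure_display)
    (Omega : measurableType d) (P : probability Omega R)
    (alpha beta : nat -> R) (K : nat -> {RV P >-> nat})
    (alpha_gt0 : forall m, 0 < alpha m) (beta_gt0 : forall m, 0 < beta m)
    (chainK : markov_chain K
       (fun m j k => ibp_transition (alpha m) (beta m) j k))
    (bounded : exists abar bbar : R,
       forall m, alpha m < abar /\ beta m < bbar) :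
  (fun m => P [set w | K m w = 0%N]) @ \oo --> 1%E.
Proof.
have [abar [bbar ab]] := bounded; have [_ Kp] := chainK.
have mS m : measurable [set w | K m w = 0%N] by exact: measurable_state_event.
apply/fine_cvgP; split; first by apply: nearW => m; exact: fin_num_measure.
(* The maximum with 1 provides [1 <= B], used to compare the mean with the harmonic sum. *)
apply: (@probability_eq0_cvg _ _ _ P alpha beta K abar (Num.max 1 bbar)) Kp => [m|m|].
- by rewrite alpha_gt0 ltW//; have [] := ab m.
- by rewrite beta_gt0 le_max orbC ltW//; have [] := ab m.
- by rewrite le_max lexx.
Qed.
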